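(* Let $G$ be a nontrivial connected graph of order $n$. Then $rvd(G)=n-1$ if and only if $G$ satisfies the following three conditions: 1. There exists at least one pair $(x,y)$ of distinct vertices with $m_G(x,y)\leq 1$. 2. For any two disjoint pairs $(x,y)$ and $(p,q)$ of vertices (that is, $x,y,p,q$ are four distinct vertices) with $m_G(x,y)\leq 1$ and $m_G(p,q)\leq 1$, the graph $G$ contains a subgraph of type (1) or of type (2) on $\{x,y\}$ and $\{p,q\}$. 3. For any three distinct vertices $x,y,z$ with $m_G(x,y)\leq 1$, $m_G(x,z)\leq 1$ and $m_G(y,z)\leq 1$, the graph $G$ contains a subgraph of type (3) or of type (4) on $\{x,y,z\}$.
   Context: All graphs are simple, finite and undirected; the order of $G$ is $n=|V(G)|$, and a graph is nontrivial if it has at least two vertices. $m_G(x,y)$ denotes the number of common neighbors of $x$ and $y$ in $G$. Subgraphs are not required to be induced. Types of subgraphs. Type (1) on $\{x,y\}$ and $\{p,q\}$: after possibly exchanging the names $x\leftrightarrow y$ and/or $p\leftrightarrow q$, there are two distinct vertices $u,v\in V(G)\setminus\{x,y,p,q\}$ such that $ux,xv,up,pv,uy,yq,qv\in E(G)$ (three internally disjoint $u$-$v$ paths $uxv$, $upv$, $uyqv$). Type (2) on $\{x,y\}$ and $\{p,q\}$: after possibly exchanging the names $x\leftrightarrow y$ and/or $p\leftrightarrow q$, one has $xp,xy,yp,xq,qp\in E(G)$. Type (3) on $\{x,y,z\}$: the triangle, i.e. $xy,yz,xz\in E(G)$. Type (4) on $\{x,y,z\}$: after possibly permuting the names $x,y,z$,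 there are two distinct vertices $u,v\in V(G)\setminus\{x,y,z\}$ such that $ux,xv,uy,yz,zv\in E(G)$ (two internally disjoint $u$-$v$ paths $uxv$ and $uyzv$). Rainbow vertex-disconnection number. Let $G$ be a nontrivial connected graph whose vertices are colored (adjacent vertices may receive the same color). A set $X\subseteq V(G)$ is rainbow if no two vertices of $X$ have the same color. For two distinct vertices $x,y$ of $G$: if $x,y$ are nonadjacent, an $x$-$y$ rainbow vertex-cut is a rainbow set $S\subseteq V(G)\setminus\{x,y\}$ such that $x$ and $y$ belong to different components of $G-S$; if $x,y$ are adjacent, an $x$-$y$ rainbow vertex-cut is a set $S\subseteq V(G)\setminus\{x,y\}$ such that $x$ and $y$ belong to different components of $(G-xy)-S$ and at least one of $S\cup\{x\}$, $S\cup\{y\}$ is rainbow. The coloring is a rainbow vertex-disconnection coloring if every two distinct vertices $x,y$ of $G$ have an $x$-$y$ rainbow vertex-cut. $rvd(G)$ is the minimum number of colors in a rainbow vertex-disconnection coloring of $G$. *)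

(* Defs.v *)
From mathcomp Require Import all_boot.

Set Implicit Arguments.
Unset Strict Implicit.
Unset Printing Implicit Defensive.

Record sgraph := SGraph {
  vertex :> finType;
  edge : rel vertex;
  edge_sym : symmetric edge;
  edge_irrefl : irreflexive edge
}.

Arguments edge {G} : rename.

Notation "x -- y" := (edge x y) (at level 30).

Definition connected (G : sgraph) : Prop := forall x y : G, connect edge x y.

Definition nontrivial (G : sgraph) : Prop := 2 <= #|G|.

Definition common_nbrs (G : sgraph) (x y : G) : nat :=
  #|[set z : G | (x -- z) && (y -- z)]|.

Definition del_edge (T : finType) (e : rel T) (x y : T) : rel T :=
  [rel u v | e u v && ([set u; v] != [set x; y])].

Definition del_vertices (T : finType) (e : rel T) (S : {set T}) : rel T :=
  [rel u v | [&& e u v, u \notin S & v \notin S]].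

(* Membership in different components of e - S includes x, y being outside S. *)
Definition separates (T : finType) (e : rel T) (S : {set T}) (x y : T) : bool :=
  [&& x \notin S, y \notin S & ~~ connect (del_vertices e S) x y].

Definition rainbow (T : finType) (C : eqType) (c : T -> C) (X : {set T}) : bool :=
  dinjectiveb c (mem X).

Definition rainbow_vertex_cut (G : sgraph) (C : eqType) (c : G -> C)
    (x y : G) (S : {set G}) : bool :=
  if x -- y then
    separates (del_edge edge x y) S x y
    && (rainbow c (x |: S) || rainbow c (y |: S))
  else
    separates edge S x y && rainbow c S.

Definition rvd_coloring (G : sgraph) (C : eqType) (c : G -> C) : bool :=
  [forall x : G, forall y : G,
     (x != y) ==> [exists S : {set G}, rainbow_vertex_cut c x y S]].

Definition rvd_colorable (G : sgraph) : pred nat :=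
  fun k => [exists c : {ffun G -> 'I_k}, rvd_coloring c].

(* Giving all vertices distinct colors always works. *)
Lemma rvd_colorable_ex (G : sgraph) : exists k, rvd_colorable G k.
Proof.
exists #|G|; apply/existsP; exists [ffun x => enum_rank x].
have rbw X : rainbow [ffun x : G => enum_rank x] X.
  by apply/dinjectiveP => u v _ _; rewrite !ffunE; apply: enum_rank_inj.
apply/forallP => x; apply/forallP => y; apply/implyP => neq_xy.
apply/existsP; exists (~: [set x; y]).
have sep (e : rel G) : ~~ e x y -> separates e (~: [set x; y]) x y.
  move=> nexy; rewrite /separates !inE !eqxx orbT /=.
  apply/connectP => -[p]; move Dn: (size p) => n.
  elim: n p Dn => [|n IHn] [|z p] //=.
    by move=> _ _ /esym /eqP; rewrite (negPf neq_xy).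
  case=> Dn /andP[/and3P[exz _]]; rewrite !inE negbK => /orP[]/eqP Dz.
    by rewrite Dz; apply: IHn.
  by rewrite Dz (negPf nexy) in exz.
rewrite /rainbow_vertex_cut; case: ifPn => [_|nexy]; last by rewrite sep ?rbw.
by rewrite sep ?rbw //= negb_and negbK eqxx orbT.
Qed.

Definition rvd (G : sgraph) : nat := ex_minn (rvd_colorable_ex G).

(* Predicates ending in _at fix the names of the vertices; the versions without
   the suffix allow the exchanges of names within each given vertex set. *)

Definition type1_at (G : sgraph) (x y p q : G) : Prop :=
  exists u v : G,
    [/\ u != v, u \notin [set x; y; p; q], v \notin [set x; y; p; q] &
        [/\ u -- x, x -- v, u -- p, p -- v & [/\ u -- y, y -- q & q -- v]]].

Definition type1 (G : sgraph) (x y p q : G) : Prop :=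
  [\/ type1_at x y p q, type1_at y x p q, type1_at x y q p | type1_at y x q p].

Definition type2_at (G : sgraph) (x y p q : G) : Prop :=
  [/\ x -- p, x -- y, y -- p, x -- q & q -- p].

Definition type2 (G : sgraph) (x y p q : G) : Prop :=
  [\/ type2_at x y p q, type2_at y x p q, type2_at x y q p | type2_at y x q p].

Definition type3 (G : sgraph) (x y z : G) : Prop :=
  [/\ x -- y, y -- z & x -- z].

Definition type4_at (G : sgraph) (x y z : G) : Prop :=
  exists u v : G,
    [/\ u != v, u \notin [set x; y; z], v \notin [set x; y; z] &
        [/\ u -- x, x -- v, u -- y, y -- z & z -- v]].

Definition type4 (G : sgraph) (x y z : G) : Prop :=
  [\/ type4_at x y z, type4_at y x z | type4_at z x y] \/
  [\/ type4_at x z y, type4_at y z x | type4_at z y x].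

(* Main.v *)
Require Import Defs.
From mathcomp Require Import all_boot.

Set Implicit Arguments.
Unset Strict Implicit.
Unset Printing Implicit Defensive.

(** Every cut between two vertices contains their common neighbors, so two
vertices of the same color in a rainbow vertex-disconnection coloring have at
most one common neighbor ([rvd_coloring_common_nbrs]).  In the other
direction, if the neighborhood of [u] is rainbow, then the neighbors of [u]
other than [v] form a rainbow cut between [u] and [v] ([inseparable_nbrs]).
Hence repeating one color, on [x] and [y] with at most one common neighbor, is
harmless: two vertices that cannot be separated would both be adjacent to [x]
and [y].  So [rvd G <= n - 1] if and only if such a pair exists.

A coloring with at most [n - 2] colors repeats its colors on two disjoint
pairs or on a triple ([rvd_colorable_merged]).  A subgraph of type (1), (2),
(3) or (4) on these vertices provides two vertices none of whose cuts is
rainbow ([type1_not_rvd] to [type4_not_rvd]).  The converse is the heart of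
the matter: among the colorings whose only coincidences are [c x = c y] and [c
p = c q], or [c x = c y = c z], on pairs with at most one common neighbor,
failing to separate some [u] and [v] forces a subgraph of the required type.
Since both neighborhoods must repeat a color, and since [u] and [v] cannot
both be adjacent to the two vertices of one pair, the neighborhood of [u]
contains one pair of equally colored vertices and that of [v] another one.
The vertices outside [u], [v] and the repeated ones can all be put in the cut,
so only cuts that leave out a few vertices matter, and the failure of each of
them yields an edge ([inseparable_sides]).  These edges make up a subgraph of
type (1) or (4) when [u] and [v] lie outside the repeated vertices, and of
type (2) or (3) when both lie inside; the mixed case is impossible
([inseparable_pairs_type], [inseparable_triple_type]). *)

(** * Separating vertex sets *)

Lemma separates_sym (T : finType) (e : rel T) (S : {set T}) :
  symmetric e -> symmetric (separates e S).
Proof.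
move=> syme x y; rewrite /separates (sym_connect_sym _ x y); first exact: andbCA.
by move=> s t; rewrite /del_vertices /= syme [(_ \notin S) && _]andbC.
Qed.

Lemma separates_sub (T : finType) (e f : rel T) (S : {set T}) x y :
  subrel f e -> separates e S x y -> separates f S x y.
Proof.
move=> sfe /and3P[xS yS]; rewrite /separates xS yS; apply: contra.
apply: connect_sub => s t /and3P[/sfe est sS tS]; apply: connect1.
by rewrite /del_vertices /= est sS tS.
Qed.

(** Everything outside two disjoint sets [A] and [B] separates [x] in [A] from
[y] in [B], as soon as no edge joins [A] to [B]. *)
Lemma separates_sides (T : finType) (e : rel T) (A B : {set T}) x y :
  x \in A -> y \in B -> [disjoint A & B] ->
  (forall s t, s \in A -> t \in B -> ~~ e s t) ->
  separates e (~: (A :|: B)) x y.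
Proof.
move=> xA yB dAB nAB; rewrite /separates !inE !negbK xA yB orbT /=.
apply/negP => /connectP[r pth lst].
have: y \in A.
  rewrite lst; elim: r x xA pth {lst} => //= t r IHr s sA.
  case/andP => /and3P[est _ tS]; apply: IHr.
  move: tS; rewrite !inE negbK => /orP[//|tB].
  by rewrite (negPf (nAB s t sA tB)) in est.
by rewrite (disjointFl dAB yB).
Qed.

(** * Rainbow cuts *)

Section Cuts.
Variable G : sgraph.
Implicit Types (u v w x y z p q : G) (A B S X : {set G}).

Lemma edge_neq u v : u -- v -> u != v.
Proof. by apply: contraTneq => ->; rewrite edge_irrefl. Qed.

Lemma common_nbrsC x y : common_nbrs x y = common_nbrs y x.
Proof. by apply: eq_card => w; rewrite !inE andbC. Qed.

Lemma common_nbrs_le1 x y u v : common_nbrs x y <= 1 ->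
  u -- x -> u -- y -> v -- x -> v -- y -> u = v.
Proof.
move=> /card_le1_eqP m1 ux uy vx vy.
by apply: m1; rewrite inE !(edge_sym x, edge_sym y) ?ux ?uy ?vx ?vy.
Qed.

Lemma del_edge_off u v s t : s -- t ->
  (s \notin [set u; v]) || (t \notin [set u; v]) ->
  del_edge edge u v s t.
Proof.
move=> st off; rewrite /del_edge /= st; apply: contraTneq off => <-.
by rewrite !inE !eqxx orbT.
Qed.

Lemma del_edge_sym u v : symmetric (del_edge (@edge G) u v).
Proof. by move=> s t; rewrite /del_edge /= edge_sym setUC. Qed.

Section Coloring.
Variables (C : eqType) (c : G -> C).

Lemma rainbowS X S : S \subset X -> rainbow c X -> rainbow c S.
Proof.
move=> sSX /dinjectiveP inj; apply/dinjectiveP => s t sS tS.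
by apply: inj; apply: (subsetP sSX).
Qed.

Lemma rainbow_same X s t :
  rainbow c X -> s \in X -> t \in X -> c s = c t -> s = t.
Proof. by move=> /dinjectiveP inj sX tX; apply: inj. Qed.

(** Whether or not [u] and [v] are adjacent, a rainbow cut separates them once
the edge [uv] is deleted. *)
Lemma rainbow_vertex_cutP u v S : rainbow_vertex_cut c u v S ->
  [/\ separates (del_edge edge u v) S u v, rainbow c S
    & u -- v -> rainbow c (u |: S) || rainbow c (v |: S)].
Proof.
rewrite /rainbow_vertex_cut; case: ifP => _ /andP[sep rb]; split=> //.
  by case/orP: rb; apply: rainbowS; apply: subsetUr.
by apply: separates_sub sep => s t /andP[].
Qed.

Lemma rainbow_vertex_cutC u v S :
  rainbow_vertex_cut c u v S = rainbow_vertex_cut c v u S.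
Proof.
have del_sym : del_edge edge u v =2 del_edge (@edge G) v u.
  by move=> s t; rewrite /del_edge /= [[set u; v]]setUC.
rewrite /rainbow_vertex_cut edge_sym orbC; case: ifP => _; last first.
  by rewrite separates_sym //; apply: edge_sym.
congr (_ && _); rewrite separates_sym; last exact: del_edge_sym.
by apply/idP/idP; apply: separates_sub => s t; rewrite del_sym.
Qed.

(** The next two lemmas say that a cut meets the interior of each [u]-[v] path
with two or three edges. *)
Lemma cut_common_nbr u v S w :
  rainbow_vertex_cut c u v S -> u -- w -> w -- v -> w \in S.
Proof.
case/rainbow_vertex_cutP => /and3P[uS vS ncon] _ _ uw wv.
have woff : w \notin [set u; v].
  by rewrite !inE negb_or eq_sym !edge_neq.
apply: contraR ncon => wS; apply: (@connect_trans _ _ w); apply: connect1.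
  by rewrite /del_vertices /= uS wS andbT (del_edge_off uw) ?woff ?orbT.
by rewrite /del_vertices /= vS wS andbT (del_edge_off wv) ?woff ?orbT.
Qed.

Lemma cut_path3 u v S a b :
  rainbow_vertex_cut c u v S -> a \notin [set u; v] -> b \notin [set u; v] ->
  u -- a -> a -- b -> b -- v -> (a \in S) || (b \in S).
Proof.
case/rainbow_vertex_cutP => /and3P[uS vS ncon] _ _ aoff boff ua ab bv.
apply: contraR ncon; rewrite negb_or => /andP[aS bS].
apply: (@connect_trans _ _ a).
  by apply: connect1; rewrite /del_vertices /= uS aS andbT del_edge_off ?aoff ?orbT.
apply: (@connect_trans _ _ b); apply: connect1.
  by rewrite /del_vertices /= aS bS andbT del_edge_off ?aoff ?orbT.
by rewrite /del_vertices /= vS bS andbT del_edge_off ?boff ?orbT.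
Qed.

Lemma rainbow_cut_sides u v A B : u \in A -> v \in B -> [disjoint A & B] ->
  (forall s t, s \in A -> t \in B -> s -- t -> s = u /\ t = v) ->
  (if u -- v then rainbow c (u |: ~: (A :|: B)) || rainbow c (v |: ~: (A :|: B))
   else rainbow c (~: (A :|: B))) ->
  rainbow_vertex_cut c u v (~: (A :|: B)).
Proof.
move=> uA vB dAB eAB; rewrite /rainbow_vertex_cut.
case: ifPn => uv ->; rewrite andbT; apply: separates_sides => // s t sA tB.
  by apply/negP => /andP[/(eAB s t sA tB)[-> ->]]; rewrite eqxx.
by apply: contra uv => st; case: (eAB s t sA tB st) => <- <-.
Qed.

(** [u] and [v] have no rainbow cut. *)
Definition inseparable u v := forall S, ~~ rainbow_vertex_cut c u v S.

Lemma inseparable_sym u v : inseparable u v -> inseparable v u.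
Proof. by move=> uv S; rewrite rainbow_vertex_cutC. Qed.

(** If the complement of two disjoint sets [A] and [B] around [u] and [v] stays
rainbow when [u] or [v] is added, and if [u] and [v] are inseparable, then this
complement is no cut: an edge other than [uv] joins [A] to [B]. *)
Lemma inseparable_sides u v A B : inseparable u v ->
  u \in A -> v \in B -> [disjoint A & B] ->
  rainbow c (u |: ~: (A :|: B)) || rainbow c (v |: ~: (A :|: B)) ->
  exists s t, [/\ s \in A, t \in B, s -- t & (s != u) || (t != v)].
Proof.
move=> nuv uA vB dAB rb.
suff /existsP[s /existsP[t /and4P[]]] : [exists s, exists t,
    [&& s \in A, t \in B, s -- t & (s != u) || (t != v)]] by exists s, t.
apply: contraR (nuv (~: (A :|: B))) => /existsPn none.
apply: rainbow_cut_sides => // [s t sA tB st|].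
  have /existsPn/(_ t) := none s; rewrite sA tB st /= negb_or !negbK.
  by case/andP => /eqP-> /eqP->.
case: ifP => // _; case/orP: rb; apply: rainbowS; exact: subsetUr.
Qed.

(** Otherwise the neighbors of [u] other than [v] would form a rainbow cut. *)
Lemma inseparable_nbrs u v : u != v -> inseparable u v ->
  ~~ rainbow c [set w | u -- w].
Proof.
move=> neq_uv nuv.
(* the cut is the neighborhood of u minus v; for the adjacent case, adding v to
   it gives back that neighborhood *)
pose B := v |: ~: (u |: [set w | u -- w]).
apply: contra (nuv (~: ([set u] :|: B))).
move=> rb; apply: rainbow_cut_sides; rewrite /B ?inE ?eqxx //.
- by rewrite disjoints1 !inE eqxx (negPf neq_uv).
- move=> s t /set1P-> /setU1P[-> //|]; rewrite !inE negb_or => /andP[_ /negPf->] //.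
case: ifP => uv; last apply: rainbowS rb.
  apply/orP; right; apply: rainbowS rb; apply/subsetP => w; rewrite !inE.
  by case/predU1P => [-> //|]; rewrite !(negb_or, negb_and, negbK) => /and3P[/negPf->].
apply/subsetP => w; rewrite !inE.
by rewrite !(negb_or, negb_and, negbK) => /and3P[/negPf->].
Qed.

Lemma rvd_coloring_common_nbrs x y :
  rvd_coloring c -> x != y -> c x = c y -> common_nbrs x y <= 1.
Proof.
move=> rvdc neq_xy cxy; rewrite leqNgt; apply/negP => /card_gt1P[u [v [uN vN uv]]].
move: uN vN; rewrite !inE => /andP[xu yu] /andP[xv yv].
have /existsP[S cutS] := implyP (forallP (forallP rvdc u) v) uv.
have [_ rbS _] := rainbow_vertex_cutP cutS.
have xS : x \in S by apply: (cut_common_nbr cutS); rewrite // edge_sym.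
have yS : y \in S by apply: (cut_common_nbr cutS); rewrite // edge_sym.
by rewrite (rainbow_same rbS xS yS cxy) eqxx in neq_xy.
Qed.

Lemma rvd_coloringPn :
  reflect (exists u v, u != v /\ inseparable u v) (~~ rvd_coloring c).
Proof.
apply: (iffP idP) => [|[u [v [uv nuv]]]].
  case/forallPn => u /forallPn[v]; rewrite negb_imply => /andP[uv /existsPn nuv].
  by exists u, v.
apply/forallPn; exists u; apply/forallPn; exists v; rewrite negb_imply uv.
exact/existsPn.
Qed.

(** * Subgraphs that no coloring with repeated colors can cut *)

(** The cuts between the end vertices [u] and [v] of the three paths contain
[x] and [p], and also [y] or [q]. *)
Lemma type1_not_rvd x y p q :
  uniq [:: x; y; p; q] -> c x = c y -> c p = c q -> type1 x y p q ->
  ~~ rvd_coloring c.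
Proof.
suff at_case a b d e : a != b -> d != e -> c a = c b -> c d = c e ->
    type1_at a b d e -> ~~ rvd_coloring c.
  rewrite /= !inE !negb_or -!andbA => /and4P[xy _ _ /and4P[_ _ pq _]] cxy cpq.
  by case; apply: at_case => //; rewrite eq_sym.
move=> ab de cab cde [u [v [uv uoff voff [ua av ud dv [ub be ev]]]]].
apply/rvd_coloringPn; exists u, v; split=> // S; apply/negP => cutS.
have [_ rbS _] := rainbow_vertex_cutP cutS.
have aS := cut_common_nbr cutS ua av; have dS := cut_common_nbr cutS ud dv.
move: uoff voff; rewrite !inE !negb_or -!andbA.
move=> /and4P[nua nub nud nue] /and4P[nva nvb nvd nve].
have: (b \in S) || (e \in S).
  apply: (cut_path3 cutS) ub be ev; rewrite !inE !(eq_sym _ u) !(eq_sym _ v).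
    by rewrite negb_or nub nvb.
  by rewrite negb_or nue nve.
by case/orP => [bS|eS];
  [move: ab; rewrite (rainbow_same rbS aS bS cab) eqxx
  |move: de; rewrite (rainbow_same rbS dS eS cde) eqxx].
Qed.

(** The adjacent vertices [x] and [p] have [y] and [q] as common neighbors. *)
Lemma type2_not_rvd x y p q :
  uniq [:: x; y; p; q] -> c x = c y -> c p = c q -> type2 x y p q ->
  ~~ rvd_coloring c.
Proof.
suff at_case a b d e : a != b -> d != e -> c a = c b -> c d = c e ->
    type2_at a b d e -> ~~ rvd_coloring c.
  rewrite /= !inE !negb_or -!andbA => /and4P[xy _ _ /and4P[_ _ pq _]] cxy cpq.
  by case; apply: at_case => //; rewrite eq_sym.
move=> ab de cab cde [ad ab' bd ae ed].
apply/rvd_coloringPn; exists a, d; split=> [|S]; first exact: edge_neq.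
apply/negP => cutS; have [_ _ /(_ ad)] := rainbow_vertex_cutP cutS.
have bS := cut_common_nbr cutS ab' bd; have eS := cut_common_nbr cutS ae ed.
case/orP => rb; [move: ab|move: de].
  by rewrite (rainbow_same rb (setU11 _ _) (setU1r _ bS) cab) eqxx.
by rewrite (rainbow_same rb (setU11 _ _) (setU1r _ eS) cde) eqxx.
Qed.

Lemma type3_not_rvd x y z :
  uniq [:: x; y; z] -> c x = c y -> c x = c z -> type3 x y z ->
  ~~ rvd_coloring c.
Proof.
rewrite /= !inE !negb_or -!andbA => /and4P[xy xz yz _] cxy cxz [exy eyz exz].
apply/rvd_coloringPn; exists x, y; split=> // S; apply/negP => cutS.
have [_ _ /(_ exy)] := rainbow_vertex_cutP cutS.
have zS : z \in S by apply: (cut_common_nbr cutS exz); rewrite edge_sym.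
have cyz : c y = c z by rewrite -cxy.
case/orP => rb; [move: xz|move: yz].
  by rewrite (rainbow_same rb (setU11 _ _) (setU1r _ zS) cxz) eqxx.
by rewrite (rainbow_same rb (setU11 _ _) (setU1r _ zS) cyz) eqxx.
Qed.

Lemma type4_not_rvd x y z :
  uniq [:: x; y; z] -> c x = c y -> c x = c z -> type4 x y z ->
  ~~ rvd_coloring c.
Proof.
suff at_case a b d : a != b -> a != d -> c a = c b -> c a = c d ->
    type4_at a b d -> ~~ rvd_coloring c.
  rewrite /= !inE !negb_or -!andbA => /and4P[xy xz yz _] cxy cxz.
  by case=> [[]|[]]; apply: at_case; rewrite // 1?eq_sym // -?cxy -?cxz.
move=> ab ad cab cad [u [v [uv uoff voff [ua av ub bd dv]]]].
apply/rvd_coloringPn; exists u, v; split=> // S; apply/negP => cutS.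
have [_ rbS _] := rainbow_vertex_cutP cutS.
have aS := cut_common_nbr cutS ua av.
move: uoff voff; rewrite !inE !negb_or -!andbA.
move=> /and3P[nua nub nud] /and3P[nva nvb nvd].
have: (b \in S) || (d \in S).
  apply: (cut_path3 cutS) ub bd dv; rewrite !inE !(eq_sym _ u) !(eq_sym _ v).
    by rewrite negb_or nub nvb.
  by rewrite negb_or nud nvd.
by case/orP => [bS|dS];
  [move: ab; rewrite (rainbow_same rbS aS bS cab) eqxx
  |move: ad; rewrite (rainbow_same rbS aS dS cad) eqxx].
Qed.

(** * Colorings repeating two colors *)

(** The only vertices that may share a color are [x] with [y] and [p] with [q];
this is put in the form in which it is used, namely that all sets containing
neither pair are rainbow. *)
Definition only_pairs_repeat x y p q :=
  forall X, ~~ ((x \in X) && (y \in X)) -> ~~ ((p \in X) && (q \in X)) ->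
  rainbow c X.

Lemma only_pairs_repeatC x y p q :
  only_pairs_repeat x y p q -> only_pairs_repeat p q x y.
Proof. by move=> rb X pqX xyX; apply: rb. Qed.

Lemma only_pairs_repeat_swapl x y p q :
  only_pairs_repeat x y p q -> only_pairs_repeat y x p q.
Proof. by move=> rb X yxX pqX; apply: rb; rewrite // andbC. Qed.

Lemma only_pairs_repeat_swapr x y p q :
  only_pairs_repeat x y p q -> only_pairs_repeat x y q p.
Proof. by move=> rb X yxX pqX; apply: rb; rewrite // andbC. Qed.

Lemma inseparable_nbrs_pairs x y p q u v :
  only_pairs_repeat x y p q -> u != v -> inseparable u v ->
  (u -- x) && (u -- y) || (u -- p) && (u -- q).
Proof.
move=> rb uv nuv; apply: contraR (inseparable_nbrs uv nuv).
by rewrite negb_or => /andP[xyN pqN]; apply: rb; rewrite !inE.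
Qed.

(** The cut leaves out only [u], [y], [q] and [v]; the path [u], [y], [q], [v]
is the only one that can defeat it. *)
Lemma pairs_outside_edge x y p q u v :
  only_pairs_repeat x y p q -> u != v -> inseparable u v ->
  u != y -> u != q -> v != y -> v != q -> y != q ->
  ~~ (u -- q) -> ~~ (y -- v) -> y -- q.
Proof.
move=> rb uv nuv uy uq vy vq yq nuq nyv.
have [||||s [t []]] := @inseparable_sides u v [set u; y] [set v; q] nuv.
- by rewrite !inE eqxx.
- by rewrite !inE eqxx.
- rewrite disjoints_subset subUset !sub1set !inE !negb_or uv uq yq.
  by rewrite eq_sym vy.
- apply/orP; left; apply: rb.
    by rewrite !inE !eqxx !(orbT, andbF) (eq_sym y) (negPf uy) andbF.
  by rewrite !inE !eqxx !(orbT, andbF) (eq_sym q) (negPf uq) andbF.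
rewrite !inE => /orP[]/eqP-> /orP[]/eqP->; rewrite ?eqxx //.
- by rewrite (negPf nuq).
- by rewrite (negPf nyv).
Qed.

(** When the color of [u] is repeated, the cuts that leave out only [u], [v]
and one of [x], [y] can be completed by [v] while remaining rainbow. *)
Lemma pairs_mixed_common x y p q u v :
  only_pairs_repeat x y p q -> u != v -> inseparable u v ->
  u \in [set p; q] -> u -- x -> u -- y -> v != x -> v != y ->
  (v -- x) && (v -- y).
Proof.
move=> rb uv nuv upq ux uy vx vy.
have nbr a : a \in [set x; y] -> u -- a -> v != a -> v -- a.
  move=> axy ua va.
  have [||||s [t []]] := @inseparable_sides u v [set u; a] [set v] nuv.
  - by rewrite !inE eqxx.
  - by rewrite !inE eqxx.
  - by rewrite disjoints_subset subUset !sub1set !inE uv eq_sym va.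
  - apply/orP; right.
    have uS : u \notin v |: ~: ([set u; a] :|: [set v]).
      by rewrite !inE eqxx (negPf uv).
    have aS : a \notin v |: ~: ([set u; a] :|: [set v]).
      by rewrite !inE eqxx orbT (eq_sym a) (negPf va).
    apply: rb.
      by case/set2P: axy => <-; rewrite (negPf aS) ?andbF.
    by case/set2P: upq => <-; rewrite (negPf uS) ?andbF.
  rewrite !inE => /orP[]/eqP-> /eqP->; rewrite ?eqxx // => av _.
  by rewrite edge_sym.
by rewrite !nbr ?inE ?eqxx ?orbT.
Qed.

(** The cut leaves out only [u], [x] and [w], and can be completed by [u]. *)
Lemma pairs_inside_edge x y p q u :
  only_pairs_repeat x y p q -> uniq [:: x; y; p; q] ->
  u \in [set p; q] -> inseparable u x -> forall w, w \in [set p; q] -> u != w ->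
  u -- w.
Proof.
move=> rb + upq nux w wpq uw.
rewrite /= !inE !negb_or -!andbA => /and4P[xy xp xq _].
have ux : u != x by move: upq; rewrite !inE => /orP[]/eqP->; rewrite eq_sym.
have [||||s [t []]] := @inseparable_sides u x [set u] [set x; w] nux.
- by rewrite !inE eqxx.
- by rewrite !inE eqxx.
- by rewrite disjoints1 !inE negb_or ux.
- have xS : x \notin u |: ~: ([set u] :|: [set x; w]).
    by rewrite !inE eqxx orbT (eq_sym x) (negPf ux).
  have wS : w \notin u |: ~: ([set u] :|: [set x; w]).
    by rewrite !inE eqxx !orbT (eq_sym w) (negPf uw).
  apply/orP; left; apply: rb; first by rewrite (negPf xS).
  by case/set2P: wpq => <-; rewrite (negPf wS) ?andbF.
by rewrite !inE => /eqP-> /orP[]/eqP->; rewrite ?eqxx.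
Qed.

Lemma type1C x y p q : type1 x y p q -> type1 p q x y.
Proof.
suff at_case (a b d e : G) : type1_at a b d e -> type1_at d e a b.
  by case=> /at_case ?; [constructor 1|constructor 3|constructor 2|constructor 4].
move=> [u [v [uv uoff voff [ua av ud dv [ub be ev]]]]]; exists v, u; split.
- by rewrite eq_sym.
- by move: voff; rewrite !inE !negb_or -!andbA => /and4P[-> -> -> ->].
- by move: uoff; rewrite !inE !negb_or -!andbA => /and4P[-> -> -> ->].
by split; [..|split]; rewrite edge_sym.
Qed.

Lemma type2C x y p q : type2 x y p q -> type2 p q x y.
Proof.
suff at_case (a b d e : G) : type2_at a b d e -> type2_at d e a b.
  by case=> /at_case ?; [constructor 1|constructor 3|constructor 2|constructor 4].
by case=> *; split; rewrite 1?edge_sym.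
Qed.

(** The case where [u] and [v] lie outside the two pairs, which are named so
that [q] is not adjacent to [u] and [y] is not adjacent to [v]. *)
Lemma pairs_outside_type1 x y p q u v :
  common_nbrs x y <= 1 -> common_nbrs p q <= 1 ->
  only_pairs_repeat x y p q -> uniq [:: x; y; p; q] ->
  u != v -> inseparable u v ->
  u -- x -> u -- y -> v -- p -> v -- q -> u \notin [set p; q] ->
  v \notin [set x; y] -> ~~ (u -- q) -> ~~ (y -- v) -> type1_at x y p q.
Proof.
move=> m_xy m_pq rb uniq4 uv nuv ux uy vp vq upq vxy nuq nyv.
move: uniq4 upq vxy; rewrite /= !inE !negb_or -!andbA.
case/and4P=> xy xp xq /and4P[yp yq pq _] /andP[up uq] /andP[vx vy].
have [u_x u_y v_p v_q] : [/\ u != x, u != y, v != p & v != q].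
  by split; apply: edge_neq.
have eyq : y -- q by apply: (pairs_outside_edge rb uv nuv).
have exv : x -- v.
  (* otherwise x -- q too, and then u and q are two common neighbors of x, y *)
  apply: contraR (uq) => nxv; apply/eqP.
  have exq : x -- q.
    by apply: (pairs_outside_edge (only_pairs_repeat_swapl rb) uv nuv).
  by apply: (common_nbrs_le1 m_xy); rewrite // edge_sym.
have eup : u -- p.
  (* otherwise y -- p too, and then v and y are two common neighbors of p, q *)
  apply: contraR (vy) => nup; apply/eqP.
  have eyp : y -- p.
    by apply: (pairs_outside_edge (only_pairs_repeat_swapr rb) uv nuv).
  by apply: (common_nbrs_le1 m_pq).
exists u, v; split; rewrite ?inE ?negb_or ?u_x ?u_y ?up ?uq ?vx ?vy ?v_p ?v_q //.
by split=> //; [rewrite edge_sym|split; rewrite // edge_sym].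
Qed.

(** Two disjoint pairs, each with at most one common neighbor, inside which the
only repetitions of colors occur. *)
Definition admissible_pairs x y p q :=
  [/\ uniq [:: x; y; p; q], common_nbrs x y <= 1, common_nbrs p q <= 1
    & only_pairs_repeat x y p q].

Lemma admissible_pairsC x y p q :
  admissible_pairs x y p q -> admissible_pairs p q x y.
Proof.
case=> uniq4 mxy mpq rb; split=> //; last exact: only_pairs_repeatC.
by rewrite (uniq_catC [:: p; q] [:: x; y]).
Qed.

Lemma admissible_pairs_swapl x y p q :
  admissible_pairs x y p q -> admissible_pairs y x p q.
Proof.
case=> uniq4 mxy mpq rb; split; rewrite // 1?common_nbrsC //.
  by rewrite (uniq_catCA [:: y] [:: x] [:: p; q]).
exact: only_pairs_repeat_swapl.
Qed.

Lemma admissible_pairs_swapr x y p q :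
  admissible_pairs x y p q -> admissible_pairs x y q p.
Proof.
by move=> ?; apply: admissible_pairsC; apply: admissible_pairs_swapl;
  apply: admissible_pairsC.
Qed.

(** The case where the inseparable vertices are [p] and [x] themselves. *)
Lemma pairs_inside_type2 x y p q :
  admissible_pairs x y p q -> inseparable p x ->
  p -- y -> x -- p -> x -- q -> type2_at x y p q.
Proof.
case=> uniq4 _ _ rb npx py xp xq.
have uniqC : uniq [:: p; q; x; y].
  by rewrite (uniq_catC [:: p; q] [:: x; y]).
have [xy pq] : x != y /\ p != q.
  by move: uniq4; rewrite /= !inE !negb_or -!andbA => /and4P[-> _ _ /and4P[_ _ -> _]].
have epq : p -- q by apply: (pairs_inside_edge rb uniq4 _ npx); rewrite ?set21 ?set22.
have exy : x -- y.
  by apply: (pairs_inside_edge (only_pairs_repeatC rb) uniqC _ (inseparable_sym npx));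
    rewrite ?set21 ?set22.
by split; rewrite // edge_sym.
Qed.

(** The case where the neighborhood of [u] contains the first pair and that of
[v] the second one. *)
Lemma pairs_type_oriented x y p q u v :
  admissible_pairs x y p q -> u != v -> inseparable u v ->
  u -- x -> u -- y -> v -- p -> v -- q -> type1 x y p q \/ type2 x y p q.
Proof.
move=> adm uv nuv ux uy vp vq; have [uniq4 m_xy m_pq rb] := adm.
have vu : v != u by rewrite eq_sym.
have nvxy : ~~ ((v -- x) && (v -- y)).
  by apply: contra uv => /andP[vx vy]; rewrite (common_nbrs_le1 m_xy ux uy vx vy).
have nupq : ~~ ((u -- p) && (u -- q)).
  by apply: contra uv => /andP[up uq]; rewrite (common_nbrs_le1 m_pq up uq vp vq).
have [upq|upq] := boolP (u \in [set p; q]);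
  have [vxy|vxy] := boolP (v \in [set x; y]).
- right.
  have inside a b d e : admissible_pairs a b d e -> u = d -> v = a ->
      u -- b -> v -- d -> v -- e -> type2_at a b d e.
    by move=> adm' ud va; rewrite ud va in nuv *; apply: pairs_inside_type2.
  have adml := admissible_pairs_swapl adm.
  case/set2P: upq => udef; case/set2P: vxy => vdef.
  + by constructor 1; apply: inside.
  + by constructor 2; apply: inside.
  + by constructor 3; apply: inside => //; apply: admissible_pairs_swapr.
  + by constructor 4; apply: inside => //; apply: admissible_pairs_swapr.
- case/negP: nvxy; move: vxy; rewrite !inE negb_or => /andP[vx vy].
  exact: (pairs_mixed_common rb uv nuv).
- case/negP: nupq; move: upq; rewrite !inE negb_or => /andP[up uq].
  exact: (pairs_mixed_common (only_pairs_repeatC rb) vu (inseparable_sym nuv)).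
left.
have outside a b d e : admissible_pairs a b d e ->
    u -- a -> u -- b -> v -- d -> v -- e -> u \notin [set d; e] ->
    v \notin [set a; b] -> ~~ (u -- e) -> ~~ (v -- b) -> type1_at a b d e.
  by case=> *; apply: pairs_outside_type1 => //; rewrite 1?[b -- v]edge_sym.
have adml := admissible_pairs_swapl adm.
have adm_r := admissible_pairs_swapr adm.
have adm_lr := admissible_pairs_swapr adml.
move: nupq nvxy; rewrite !negb_and => /orP[nup|nuq] /orP[nvx|nvy].
- by constructor 4; apply: outside; rewrite // 1?setUC.
- by constructor 3; apply: outside; rewrite // 1?setUC.
- by constructor 2; apply: outside; rewrite // 1?setUC.
- by constructor 1; apply: outside.
Qed.

Lemma inseparable_pairs_type x y p q u v :
  admissible_pairs x y p q -> u != v -> inseparable u v ->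
  type1 x y p q \/ type2 x y p q.
Proof.
move=> adm uv nuv; have [_ m_xy m_pq rb] := adm.
have vu : v != u by rewrite eq_sym.
have := inseparable_nbrs_pairs rb vu (inseparable_sym nuv).
have := inseparable_nbrs_pairs rb uv nuv.
case/orP => /andP[u1 u2] /orP[]/andP[v1 v2].
- by rewrite (common_nbrs_le1 m_xy u1 u2 v1 v2) eqxx in uv.
- exact: (pairs_type_oriented adm uv nuv).
- have [] := pairs_type_oriented (admissible_pairsC adm) uv nuv u1 u2 v1 v2.
    by left; apply: type1C.
  by right; apply: type2C.
- by rewrite (common_nbrs_le1 m_pq u1 u2 v1 v2) eqxx in uv.
Qed.

(** * Colorings repeating one color three times *)

(** The only vertices that may share a color are [x], [y] and [z]: the sets
that contain at most one of them are rainbow. *)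
Definition only_triple_repeats x y z :=
  forall X, ~~ ((x \in X) && (y \in X)) -> ~~ ((x \in X) && (z \in X)) ->
    ~~ ((y \in X) && (z \in X)) -> rainbow c X.

Lemma inseparable_nbrs_triple x y z u v :
  only_triple_repeats x y z -> u != v -> inseparable u v ->
  [|| (u -- x) && (u -- y), (u -- x) && (u -- z) | (u -- y) && (u -- z)].
Proof.
move=> rb uv nuv; apply: contraR (inseparable_nbrs uv nuv).
by rewrite !negb_or => /and3P[xyN xzN yzN]; apply: rb; rewrite !inE.
Qed.

(** Three distinct vertices, pairwise with at most one common neighbor, which
are the only ones that may share a color. *)
Definition admissible_triple x y z :=
  [/\ uniq [:: x; y; z], common_nbrs x y <= 1, common_nbrs x z <= 1,
      common_nbrs y z <= 1 & only_triple_repeats x y z].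

Lemma admissible_triple_swap12 x y z :
  admissible_triple x y z -> admissible_triple y x z.
Proof.
case=> uniq3 xy xz yz rb; split; rewrite // 1?common_nbrsC //.
  by rewrite (uniq_catCA [:: y] [:: x] [:: z]).
by move=> X yx yz' xz'; apply: rb; rewrite // andbC.
Qed.

Lemma admissible_triple_swap23 x y z :
  admissible_triple x y z -> admissible_triple x z y.
Proof.
case=> uniq3 xy xz yz rb; split; rewrite // 1?common_nbrsC //.
  by move: uniq3; rewrite /= !inE (orbC (x == z)) (eq_sym z).
by move=> X xz' xy' zy; apply: rb; rewrite // andbC.
Qed.

(** The case where [x] is the common neighbor of [u] and [v] among the three
vertices, [y] being adjacent to [u] only and [z] to [v] only. *)
Lemma triple_type_oriented x y z u v :
  admissible_triple x y z -> u != v -> inseparable u v ->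
  u -- x -> u -- y -> v -- x -> v -- z -> type3 x y z \/ type4_at x y z.
Proof.
case=> uniq3 mxy mxz myz rb uv nuv ux uy vx vz.
move: uniq3; rewrite /= !inE !negb_or -!andbA => /and4P[xy xz yz _].
have nuz : ~~ (u -- z).
  by apply: contra uv => uz; rewrite (common_nbrs_le1 mxz ux uz vx vz).
have nvy : ~~ (v -- y).
  by apply: contra uv => vy; rewrite (common_nbrs_le1 mxy ux uy vx vy).
have [u_x u_y v_x v_z] : [/\ u != x, u != y, v != x & v != z].
  by split; apply: edge_neq.
have [udef|u_z] := eqVneq u z; have [vdef|v_y] := eqVneq v y.
- left; split; first by rewrite edge_sym -vdef.
    by rewrite -udef edge_sym.
  by rewrite edge_sym -udef.
- (* u = z: the cut leaving out u, y and v is rainbow even with v added *)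
  have [||||s [t []]] := @inseparable_sides u v [set u; y] [set v] nuv.
  + by rewrite !inE eqxx.
  + by rewrite !inE eqxx.
  + by rewrite disjoints_subset subUset !sub1set !inE uv eq_sym v_y.
  + have zS : z \notin v |: ~: ([set u; y] :|: [set v]).
      by rewrite -udef !inE eqxx (negPf uv).
    have yS : y \notin v |: ~: ([set u; y] :|: [set v]).
      by rewrite !inE eqxx orbT (eq_sym y) (negPf v_y).
    by apply/orP; right; apply: rb; rewrite ?(negPf zS) ?(negPf yS) ?andbF.
  rewrite !inE => /orP[]/eqP-> /eqP->; rewrite ?eqxx //.
  by rewrite edge_sym (negPf nvy).
- (* v = y: the cut leaving out u, v and z is rainbow even with u added *)
  have [||||s [t []]] := @inseparable_sides u v [set u] [set v; z] nuv.
  + by rewrite !inE eqxx.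
  + by rewrite !inE eqxx.
  + by rewrite disjoints1 !inE negb_or uv.
  + have zS : z \notin u |: ~: ([set u] :|: [set v; z]).
      by rewrite !inE eqxx !orbT (eq_sym z) (negPf u_z).
    have yS : y \notin u |: ~: ([set u] :|: [set v; z]).
      by rewrite -vdef !inE eqxx !orbT (eq_sym v) (negPf uv).
    by apply/orP; left; apply: rb; rewrite ?(negPf zS) ?(negPf yS) ?andbF.
  rewrite !inE => /eqP-> /orP[]/eqP->; rewrite ?eqxx //.
  by rewrite (negPf nuz).
right; exists u, v.
have eyz : y -- z.
  have [||||s [t []]] := @inseparable_sides u v [set u; y] [set v; z] nuv.
  + by rewrite !inE eqxx.
  + by rewrite !inE eqxx.
  + by rewrite disjoints_subset subUset !sub1set !inE !negb_or uv u_z yz eq_sym v_y.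
  + have zS : z \notin u |: ~: ([set u; y] :|: [set v; z]).
      by rewrite !inE eqxx !orbT (eq_sym z) (negPf u_z).
    have yS : y \notin u |: ~: ([set u; y] :|: [set v; z]).
      by rewrite !inE eqxx !orbT (eq_sym y) (negPf u_y).
    by apply/orP; left; apply: rb; rewrite ?(negPf zS) ?(negPf yS) ?andbF.
  rewrite !inE => /orP[]/eqP-> /orP[]/eqP->; rewrite ?eqxx //.
    by rewrite (negPf nuz).
  by rewrite edge_sym (negPf nvy).
split; rewrite ?inE ?negb_or ?u_x ?u_y ?u_z ?v_x ?v_y ?v_z //.
by split=> //; rewrite edge_sym.
Qed.

Lemma type3_swap12 x y z : type3 x y z -> type3 y x z.
Proof. by case=> xy yz xz; split=> //; rewrite edge_sym. Qed.

Lemma type3_swap23 x y z : type3 x y z -> type3 x z y.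
Proof. by case=> xy yz xz; split=> //; rewrite edge_sym. Qed.

Lemma inseparable_triple_type x y z u v :
  admissible_triple x y z -> u != v -> inseparable u v ->
  type3 x y z \/ type4 x y z.
Proof.
move=> adm uv nuv; have [_ mxy mxz myz rb] := adm.
have vu : v != u by rewrite eq_sym.
have := inseparable_nbrs_triple rb vu (inseparable_sym nuv).
have := inseparable_nbrs_triple rb uv nuv.
have adm_yxz := admissible_triple_swap12 adm.
have adm_xzy := admissible_triple_swap23 adm.
have adm_yzx := admissible_triple_swap23 adm_yxz.
have adm_zxy := admissible_triple_swap12 adm_xzy.
have adm_zyx := admissible_triple_swap12 adm_yzx.
have same a b : common_nbrs a b <= 1 -> u -- a -> u -- b -> v -- a -> v -- b ->
    type3 x y z \/ type4 x y z.
  by move=> m ua ub va vb; rewrite (common_nbrs_le1 m ua ub va vb) eqxx in uv.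
(* local copies of these facts let auto restore the order of x, y and z *)
have t3 := @type3_swap12; have t3' := @type3_swap23.
case/or3P => /andP[u1 u2] /or3P[]/andP[v1 v2]; try by [apply: same v1 v2].
- have [|?] := triple_type_oriented adm uv nuv u1 u2 v1 v2; first by left.
  by right; left; constructor 1.
- have [|?] := triple_type_oriented adm_yxz uv nuv u2 u1 v1 v2; first by left; auto.
  by right; left; constructor 2.
- have [|?] := triple_type_oriented adm_xzy uv nuv u1 u2 v1 v2; first by left; auto.
  by right; right; constructor 1.
- have [|?] := triple_type_oriented adm_zxy uv nuv u2 u1 v2 v1; first by left; auto.
  by right; left; constructor 3.
- have [|?] := triple_type_oriented adm_yzx uv nuv u1 u2 v2 v1; first by left; auto.
  by right; right; constructor 2.
- have [|?] := triple_type_oriented adm_zyx uv nuv u2 u1 v2 v1; first by left; auto.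
  by right; right; constructor 3.
Qed.

End Coloring.

(** * Numbers of colors *)

Lemma rvd_coloring_finer (C D : eqType) (c : G -> C) (d : G -> D) :
  (forall s t, d s = d t -> c s = c t) -> rvd_coloring c -> rvd_coloring d.
Proof.
move=> finer; have rb X : rainbow c X -> rainbow d X.
  move=> /dinjectiveP inj; apply/dinjectiveP => s t sX tX /finer; exact: inj.
move=> /forallP rvdc; apply/forallP => u; apply/forallP => v; apply/implyP => uv.
have /existsP[S cutS] := implyP (forallP (rvdc u) v) uv.
apply/existsP; exists S; move: cutS; rewrite /rainbow_vertex_cut.
case: ifP => _ /andP[-> rbS] /=; last exact: rb.
by case/orP: rbS => /rb ->; rewrite ?orbT.
Qed.

(** A coloring of the vertices by vertices, with colors in [A], uses at most
[#|A|] colors. *)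
Lemma rvd_colorable_image (c : G -> G) (A : {set G}) :
  (forall s, c s \in A) -> rvd_coloring c -> rvd_colorable G #|A|.
Proof.
move=> cA rvdc; apply/existsP.
exists [ffun s => enum_rank_in (cA s) (c s)].
apply: rvd_coloring_finer rvdc => s t; rewrite !ffunE.
move/(congr1 enum_val); rewrite !enum_rankK_in //.
Qed.

(** Let [r] choose a representative in each color class, and let [B] be the
set of the vertices that are not chosen: there are at most [k] chosen
vertices. *)
Lemma rvd_colorable_merged k : rvd_colorable G k ->
  exists (c : G -> 'I_k) (r : G -> G) (B : {set G}),
  [/\ rvd_coloring c, #|G| <= k + #|B|, forall s, c (r s) = c s,
      forall s, r s \notin B & forall s, s \in B -> r s != s].
Proof.
case/existsP => c rvdc.
pose r s := odflt s [pick t | c t == c s].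
have cr s : c (r s) = c s.
  by rewrite /r; case: pickP => [t /eqP //|].
have rr s t : c s = c t -> r s = r t.
  move=> cst; rewrite /r cst; case: pickP => // /(_ t); by rewrite eqxx.
exists c, r, [set s | r s != s]; split=> // [|s|s]; last first.
- by rewrite inE.
- by rewrite inE negbK; apply/eqP/rr/cr.
rewrite -(cardsC [set s | r s != s]) addnC leq_add2r -[leqRHS]card_ord.
rewrite -(@card_in_imset _ _ c) ?max_card // => s t.
by rewrite !inE !negbK => /eqP {2}<- /eqP {2}<-; apply: rr.
Qed.

End Cuts.

Lemma rvdP (G : sgraph) k :
  rvd G = k <-> rvd_colorable G k /\ forall j, rvd_colorable G j -> k <= j.
Proof.
rewrite /rvd; case: ex_minnP => m colm minm; split=> [<- //|[colk mink]].
by apply/eqP; rewrite eqn_leq minm ?mink.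
Qed.

(** One repetition, between vertices with at most one common neighbor, is
always possible. *)
Lemma rvd_colorable_common_nbrs (G : sgraph) (x y : G) :
  x != y -> common_nbrs x y <= 1 -> rvd_colorable G (#|G| - 1).
Proof.
move=> xy m_xy; pose c s := if s == y then x else s.
have -> : #|G| - 1 = #|[set~ y]| by rewrite cardsC1 subn1.
apply: (@rvd_colorable_image _ c).
  by move=> s; rewrite !inE /c; case: ifPn.
have rb (X : {set G}) : ~~ ((x \in X) && (y \in X)) -> rainbow c X.
  move=> xyX; apply/dinjectiveP => s t sX tX; rewrite /c.
  by case: eqVneq => [sy|_]; case: eqVneq => [ty|_] // st; subst => //;
    move: xyX; rewrite ?sX ?tX.
rewrite -[rvd_coloring c]negbK; apply/negP => /rvd_coloringPn[u [v [uv nuv]]].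
have vu : v != u by rewrite eq_sym.
have nbr w w' : w != w' -> inseparable c w w' -> (w -- x) && (w -- y).
  move=> ww' nww'; apply: contraR (inseparable_nbrs ww' nww') => ?.
  by apply: rb; rewrite !inE.
have /andP[ux uy] := nbr u v uv nuv.
have /andP[vx vy] := nbr v u vu (inseparable_sym nuv).
by rewrite (common_nbrs_le1 m_xy ux uy vx vy) eqxx in uv.
Qed.

(** The coloring by vertices where [y] gets color [x], [q] gets color [p], and
every other vertex keeps its own name as its color. *)
Definition merge (G : sgraph) (x y p q s : G) : G :=
  if s == y then x else if s == q then p else s.

Lemma rvd_colorable_merge (G : sgraph) (x y p q : G) :
  y != q -> x \notin [set y; q] -> p \notin [set y; q] ->
  rvd_coloring (merge x y p q) -> rvd_colorable G (#|G| - 2).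
Proof.
move=> yq xoff poff.
have -> : #|G| - 2 = #|~: [set y; q]| by rewrite [RHS]cardsCs setCK cards2 yq.
apply: rvd_colorable_image => s; rewrite /merge inE.
by case: eqVneq => // sy; case: eqVneq => // sq; rewrite !inE negb_or sy.
Qed.

Lemma merge_pairs (G : sgraph) (x y p q : G) :
  uniq [:: x; y; p; q] -> only_pairs_repeat (merge x y p q) x y p q.
Proof.
rewrite /= !inE !negb_or -!andbA => /and4P[_ xp _ _] X xyX pqX.
apply/dinjectiveP => s t sX tX; rewrite /merge.
case: (eqVneq s y) => [sy|_]; case: (eqVneq t y) => [ty|_];
  case: (eqVneq s q) => [sq|_]; case: (eqVneq t q) => [tq|_] st; subst=> //;
  by move: xyX pqX xp; rewrite ?sX ?tX ?eqxx.
Qed.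

Lemma merge_triple (G : sgraph) (x y z : G) :
  only_triple_repeats (merge x y x z) x y z.
Proof.
move=> X xyX xzX yzX; apply/dinjectiveP => s t sX tX; rewrite /merge.
case: (eqVneq s y) => [sy|_]; case: (eqVneq t y) => [ty|_];
  case: (eqVneq s z) => [sz|_]; case: (eqVneq t z) => [tz|_] st; subst=> //;
  by move: xyX xzX yzX; rewrite ?sX ?tX.
Qed.

Theorem theorem4p1 (G : sgraph) (ntG : nontrivial G) (cG : connected G) :
  rvd G = #|G| - 1 <->
  [/\ exists x y : G, x != y /\ common_nbrs x y <= 1,
      forall x y p q : G, uniq [:: x; y; p; q] ->
        common_nbrs x y <= 1 -> common_nbrs p q <= 1 ->
        type1 x y p q \/ type2 x y p q
    & forall x y z : G, uniq [:: x; y; z] ->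
        common_nbrs x y <= 1 -> common_nbrs x z <= 1 -> common_nbrs y z <= 1 ->
        type3 x y z \/ type4 x y z].
Proof.
have G_gt0 : 0 < #|G| by apply: leq_trans ntG.
have not_n2 : rvd G = #|G| - 1 -> ~~ rvd_colorable G (#|G| - 2).
  move=> /rvdP[_ minG]; apply/negP => /minG; rewrite leqNgt.
  by rewrite ltn_sub2l.
split=> [rvdG|[[x [y [xy m_xy]]] cond2 cond3]].
  have /rvdP[colG _] := rvdG; split.
  - have [c [r [B [rvdc cardB cr rB Br]]]] := rvd_colorable_merged colG.
    have /card_gt0P[y yB] : 0 < #|B|.
      by rewrite -(ltn_add2l (#|G| - 1)) addn0 (leq_trans _ cardB) // subn1 prednK.
    exists (r y), y; split; first exact: Br.
    by apply: (rvd_coloring_common_nbrs rvdc); [apply: Br|].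
  - move=> x y p q uniq4 m_xy m_pq.
    have adm : admissible_pairs (merge x y p q) x y p q.
      by split=> //; apply: merge_pairs.
    have [u [v [uv nuv]]] : exists u v, u != v /\ inseparable (merge x y p q) u v.
      apply/rvd_coloringPn; apply: contra (not_n2 rvdG).
      move: uniq4; rewrite /= !inE !negb_or -!andbA => /and4P[xy xp xq /and4P[yp yq pq _]].
      by apply: rvd_colorable_merge; rewrite // !inE negb_or ?xy // eq_sym yp.
    exact: inseparable_pairs_type adm uv nuv.
  move=> x y z uniq3 m_xy m_xz m_yz.
  have adm : admissible_triple (merge x y x z) x y z.
    by split=> //; apply: merge_triple.
  have [u [v [uv nuv]]] : exists u v, u != v /\ inseparable (merge x y x z) u v.
    apply/rvd_coloringPn; apply: contra (not_n2 rvdG).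
    move: uniq3; rewrite /= !inE !negb_or -!andbA => /and4P[xy xz yz _].
    by apply: rvd_colorable_merge; rewrite // !inE negb_or xy.
  exact: inseparable_triple_type adm uv nuv.
apply/rvdP; split; first exact: rvd_colorable_common_nbrs m_xy.
move=> k /rvd_colorable_merged[c [r [B [rvdc cardB cr rB Br]]]].
rewrite leqNgt; apply/negP => k_small.
have /card_gt1P[b [d [bB dB bd]]] : 1 < #|B|.
  rewrite -(ltn_add2l k) addn1 (leq_trans _ cardB) //.
  by rewrite -ltn_predRL -subn1.
have off s t : t \in B -> r s != t by apply: contraTneq => <-.
have m_le s : s \in B -> common_nbrs (r s) s <= 1.
  by move=> sB; apply: (rvd_coloring_common_nbrs rvdc); rewrite ?Br.
(* the equally colored pairs r b, b and r d, d are disjoint, or form a triple *)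
have [rbd|rbd] := eqVneq (r b) (r d).
  have uniq3 : uniq [:: r b; b; d].
    by rewrite /= !inE !negb_or !off // bd.
  have cbd : c b = c d by rewrite -cr rbd cr.
  have m_bd : common_nbrs b d <= 1 by apply: (rvd_coloring_common_nbrs rvdc).
  have [|t|t] := cond3 _ _ _ uniq3 (m_le b bB) _ m_bd; first by rewrite rbd m_le.
    by move: (type3_not_rvd uniq3 (cr b) (etrans (cr b) cbd) t); rewrite rvdc.
  by move: (type4_not_rvd uniq3 (cr b) (etrans (cr b) cbd) t); rewrite rvdc.
have uniq4 : uniq [:: r b; b; r d; d].
  by rewrite /= !inE !negb_or rbd bd (eq_sym b) !off.
have [t|t] := cond2 _ _ _ _ uniq4 (m_le b bB) (m_le d dB).
  by move: (type1_not_rvd uniq4 (cr b) (cr d) t); rewrite rvdc.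
by move: (type2_not_rvd uniq4 (cr b) (cr d) t); rewrite rvdc.
Qed.
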